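(* Let $n,K\ge 1$ and let $\boldsymbol{X}_1,\dots,\boldsymbol{X}_n$ be independent multinoulli random vectors, $\boldsymbol{X}_i=(X_{i1},\dots,X_{iK})$, with $p_{ik}=\mathbb{P}(X_{ik}=1)\in[0,1]$ for $i=1,\dots,n$ and $k=1,\dots,K$. Then for all $\epsilon>0$, $$\mathbb{P}\left(\left|\sum_{i=1}^n\sum_{k=1}^K (X_{ik}-p_{ik})\log p_{ik}\right|\ge n\epsilon\right)\le 2K\exp\left\{-\frac{n\epsilon^2}{2K(K+\epsilon)}\right\}.$$
   Context: A multinoulli (categorical) random vector $\boldsymbol{X}=(X_1,\dots,X_K)$ takes values in $\{0,1\}^K$ with exactly one coordinate equal to $1$; thus $\sum_{k=1}^K \mathbb{P}(X_k=1)=1$. $\log$ is the natural logarithm. The convention $0\log 0=0$ is used, so that when $p_{ik}=0$ the term $(X_{ik}-p_{ik})\log p_{ik}$ equals $0$ almost surely. *)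

(* Defs.v *)
From HB Require Import structures.
From mathcomp Require Export all_boot all_order all_algebra.
From mathcomp Require Export all_classical all_reals all_analysis.

Set Implicit Arguments.
Unset Strict Implicit.
Unset Printing Implicit Defensive.

Export Order.TTheory GRing.Theory Num.Theory.
Export numFieldNormedType.Exports.

Local Open Scope classical_set_scope.
Local Open Scope ring_scope.

Definition one_hot (R : realType) (K : nat) (x : K.-tuple R) : Prop :=
  (forall k, tnth x k = 0 \/ tnth x k = 1) /\ exists! k, tnth x k = 1.

(* Random vectors are measurable for the product of the Borel sigma-algebras
   of R, which is the library's sigma-algebra on K.-tuple R. *)
Definition multinoulli d (T : measurableType d) (R : realType)
    (P : probability T R) (K : nat) (X : {RV P >-> K.-tuple R}) : Prop :=
  forall w, one_hot (X w).

Definition mutually_independent d (T : measurableType d) (R : realType)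
    (P : probability T R) d' (U : measurableType d') (I : finType)
    (X : I -> {RV P >-> U}) : Prop :=
  forall (J : {set I}) (B : I -> set U), (forall i, measurable (B i)) ->
    P (\bigcap_(i in [set` J]) (X i @^-1` B i)) =
    (\prod_(i in J) P (X i @^-1` B i))%E.

(* Main.v *)
Require Import Defs.
From mathcomp Require Import ring lra.

(** Fix k and put q_i = p i k, delta = eps / K. The deviation can only exceed
    n eps if, for some k, the k-th sum Z_k exceeds n delta in absolute value, so
    by a union bound it is enough to bound each P(|Z_k| >= n delta) by
    2 exp(- n delta^2 / (2 (1 + delta))). This is Chernoff's method with
    parameter a = delta / (1 + delta), applied to the product law of the 0/1
    pattern (X_ik)_i. With L = - log q >= 0, the logarithm of the moment
    generating function of +-(X - q) log q at a is at most
    q (e^(a L) - 1 - a L), and since q = e^(- L) this is at most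
    a^2 / (2 (1 - a)) uniformly in q. *)

Local Open Scope classical_set_scope.
Local Open Scope ring_scope.

Lemma ger0_is_derive_le (R : realType) (f df : R -> R) (x : R) :
  (forall y, is_derive y (1 : R) f (df y)) -> (forall y, 0 <= y -> 0 <= df y) ->
  0 <= x -> f 0 <= f x.
Proof.
move=> fE df0 x0.
have fd y : derivable f y 1 by case: (fE y).
apply: (@ger0_derive1_le_cc R f 0 x) => //.
- move=> y /[!in_itv]/= /andP[/ltW y0 _]; rewrite derive1E.
  by case: (fE y) => _ ->; exact: df0.
- apply: continuous_subspaceT => y.
  exact/differentiable_continuous/derivable1_diffP.
- by rewrite in_itv /= lexx.
- by rewrite in_itv /= lexx x0.
Qed.

Lemma is_derive_expRM (R : realType) (a x : R) :
  is_derive x (1 : R) (fun y => expR (a * y)) (a * expR (a * x)).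
Proof.
have H : is_derive x (1 : R) ( *%R a) (a * 1).
  apply: (is_deriveZ a (is_derive_id x 1)).
have := @is_derive1_comp R expR _ x _ _ (is_derive_expR _) H.
rewrite mulr1 [X in _ -> is_derive _ _ _ X]mulrC => H2.
apply H2.
Qed.

(** Right side minus left side equals [a ^+ 2] at 0 and is nondecreasing: its derivative is
    nonnegative once 2 (1 - a) (e^(a y) - 1) <= a e^y. *)
Lemma expR_tail_le (R : realType) (a x : R) : 0 <= a < 1 -> 0 <= x ->
  2 * (1 - a) * (expR (a * x) - 1 - a * x) <= a ^+ 2 * expR x.
Proof.
move=> /andP[a0 a1] x0.
have a1' : 0 < 1 - a by rewrite subr_gt0.
pose f y : R := a ^+ 2 * expR (1 * y) -
  2 * (1 - a) * (expR (a * y) - 1 - a * y).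
suff : f 0 <= f x.
  rewrite /f !mulr0 !expR0 mul1r; have := sqr_ge0 a; lra.
pose df y : R := a ^+ 2 * (1 * expR (1 * y)) -
  2 * (1 - a) * (a * expR (a * y) - 0 - a * 1).
apply: (@ger0_is_derive_le _ _ df) => // y.
  have H1 := @is_derive_expRM R 1 y; have H2 := @is_derive_expRM R a y.
  by rewrite /f /df; apply: is_deriveB.
move=> y0; rewrite /df !mul1r mulr1 subr0.
set E := expR (a * (y - 1)); have E0 : 0 < E by exact: expR_gt0.
have E1 : E * expR ((1 - a) * (y - 1)) = expR (y - 1).
  by rewrite -expRD; congr expR; ring.
have E2 : E * expR (- (a * (y - 1))) = 1 by rewrite -expRD subrr expR0.
(* Weighted AM-GM: e^(a t) <= a e^t + (1 - a) at t = y - 1. *)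
have EE : E <= a * expR (y - 1) + (1 - a).
  rewrite -E1 -[X in _ + X]mulr1 -[X in _ + _ * X]E2.
  have := ler_wpM2l (ltW E0) (expR_ge1Dx ((1 - a) * (y - 1))).
  move=> /(ler_wpM2l a0).
  have := ler_wpM2l (ltW E0) (expR_ge1Dx (- (a * (y - 1)))).
  by move=> /(ler_wpM2l (ltW a1')); nra.
(* 1 - a <= e^(- a) absorbs the factor 1 - a into the shift of y by 1; the shift is then repaid by 2
   <= e. *)
have Ea : (1 - a) * expR (a * y) <= E.
  have -> : E = expR (- a) * expR (a * y).
    by rewrite -expRD; congr expR; ring.
  by rewrite ler_pM2r ?expR_gt0//; exact: expR_ge1Dx.
have e2 : 2 * expR (y - 1) <= expR y.
  have -> : expR y = expR 1 * expR (y - 1).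
    by rewrite -expRD; congr expR; ring.
  by rewrite ler_pM2r ?expR_gt0//; exact: expR_ge1Dx.
have : (1 - a) * expR (a * y) <= a * expR (y - 1) + (1 - a).
  exact: le_trans EE.
move=> /(ler_wpM2l a0) H; have := ler_wpM2l (sqr_ge0 a) e2.
lra.
Qed.

Lemma sinh_ge (R : realType) (x : R) : 0 <= x -> 2 * x <= expR x - expR (- x).
Proof.
move=> x0.
pose f y : R := expR (1 * y) - expR ((-1) * y) - 2 * y.
suff : f 0 <= f x.
  by rewrite /f !mulr0 !expR0 mul1r mulN1r; lra.
apply: (@ger0_is_derive_le _ _
  (fun y => 1 * expR (1 * y) - (-1) * expR ((-1) * y) - 2 * 1)) => // y.
  have H1 := @is_derive_expRM R 1 y; have H2 := @is_derive_expRM R (-1) y.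
  by rewrite /f; apply: is_deriveB.
move=> _; rewrite !mul1r !mulN1r.
by have := expR_ge1Dx y; have := expR_ge1Dx (- y); lra.
Qed.

(** For x < 0 this is [sinh_ge] at - x. It lets a tilt of either sign be treated as a positive
    one. *)
Lemma expR_sub1D_norm_le (R : realType) (x : R) :
  expR x - 1 - x <= expR `|x| - 1 - `|x|.
Proof.
have [x0|/ltW x0] := leP 0 x; first by rewrite ger0_norm.
have := @sinh_ge R (- x); rewrite oppr_ge0 x0 opprK => /(_ isT).
by rewrite ler0_norm//; lra.
Qed.

(** Factoring out e^(- mu q l) leaves 1 + q (e^(mu l) - 1), and 1 + t <= e^t turns the whole into
    exp(q (e^(mu l) - 1 - mu l)), whose exponent is bounded by [core]. *)
Lemma log_bernoulli_mgf_le (R : realType) (q mu : R) :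
  0 <= q <= 1 -> `|mu| < 1 ->
  q * expR (mu * ((1 - q) * ln q)) + (1 - q) * expR (mu * ((0 - q) * ln q)) <=
  expR (mu ^+ 2 / (2 * (1 - `|mu|))).
Proof.
move=> /andP[q0 q1] mu1; set l := ln q.
have l0 : l <= 0 by exact: ln_le0.
have d0 : 0 < 2 * (1 - `|mu|) by rewrite mulr_gt0// subr_gt0.
have core : q * (expR (mu * l) - 1 - mu * l) <= mu ^+ 2 / (2 * (1 - `|mu|)).
  rewrite ler_pdivlMr//.
  (* The cancellation q e^(- l) = 1 fails at q = 0, where [ln] is 0 by default; there the left side
     vanishes. *)
  have [->|qn0] := eqVneq q 0; first by rewrite !mul0r sqr_ge0.
  have qp : 0 < q by rewrite lt_neqAle eq_sym qn0.
  have E : `|mu * l| = `|mu| * - l by rewrite normrM (ler0_norm l0).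
  have ql : q * expR (- l) = 1.
    by rewrite expRN lnK ?posrE// divff.
  have := @expR_tail_le R `|mu| (- l); rewrite normr_ge0 mu1 oppr_ge0 l0.
  move=> /(_ isT isT); rewrite -E => H1.
  have := ler_wpM2l (ltW d0) (expR_sub1D_norm_le _ (mu * l)) => H2.
  have := ler_wpM2l q0 (le_trans H2 H1).
  rewrite [q * (_ ^+ 2 * _)]mulrCA ql mulr1 real_normK ?num_real//.
  by apply: le_trans; rewrite le_eqVlt; apply/orP; left; apply/eqP; ring.
have -> : q * expR (mu * ((1 - q) * l)) + (1 - q) * expR (mu * ((0 - q) * l)) =
    expR (- (mu * q * l)) * (1 + q * (expR (mu * l) - 1)).
  have -> : mu * ((1 - q) * l) = - (mu * q * l) + mu * l by ring.
  have -> : mu * ((0 - q) * l) = - (mu * q * l) by ring.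
  by rewrite expRD; ring.
apply: (@le_trans _ _ (expR (- (mu * q * l) + q * (expR (mu * l) - 1)))).
  by rewrite expRD ler_pM2l ?expR_gt0//; exact: expR_ge1Dx.
by rewrite ler_expR; apply: le_trans core; lra.
Qed.

Lemma chernoff_log_bernoulli (R : realType) (I : finType) (q : I -> R)
    (s delta : R) : (forall i, 0 <= q i <= 1) -> `|s| = 1 -> 0 < delta ->
  \sum_(f : {ffun I -> bool} | #|I|%:R * delta <=
      s * \sum_i ((f i)%:R - q i) * ln (q i))
    \prod_i (if f i then q i else 1 - q i) <=
  expR (- (#|I|%:R * (delta ^+ 2 / (2 * (1 + delta))))).
Proof.
move=> q01 s1 d0; set N : R := #|I|%:R.
have d1 : 0 < 1 + delta by rewrite addr_gt0.
(* With 1 - a = 1 / (1 + delta), the exponent - a delta + a^2 / (2 (1 - a)) is exactly - delta^2 /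
   (2 (1 + delta)). *)
pose a := delta / (1 + delta).
have a0 : 0 < a by rewrite divr_gt0.
have aE : 1 - a = (1 + delta)^-1 by rewrite /a; field; rewrite gt_eqF.
have na : `|a * s| = a by rewrite normrM s1 mulr1 gtr0_norm.
have w0 (f : {ffun I -> bool}) i : 0 <= (if f i then q i else 1 - q i).
  by have /andP[? ?] := q01 i; case: ifP; rewrite ?subr_ge0.
pose Z (f : {ffun I -> bool}) := \sum_i ((f i)%:R - q i) * ln (q i).
(* Markov step: the factor e^(a (s Z - N delta)) is at least 1 on the event, and the patterns
   outside add nonnegative terms. *)
apply: (@le_trans _ _ (\sum_(f : {ffun I -> bool}) expR (- (a * (N * delta))) *
    \prod_i ((if f i then q i else 1 - q i) *
             expR (a * s * (((f i)%:R - q i) * ln (q i)))))).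
  rewrite [leRHS](bigID (fun f => N * delta <= s * Z f))/= -[leLHS]addr0.
  apply: lerD; last first.
    apply: sumr_ge0 => f _; rewrite mulr_ge0 ?expR_ge0// prodr_ge0// => i _.
    by rewrite mulr_ge0 ?expR_ge0.
  apply: ler_sum => f Hf.
  rewrite big_split/= -expR_sum mulrCA -expRD -[leLHS]mulr1.
  apply: ler_wpM2l; first exact: prodr_ge0.
  rewrite -[leLHS]expR0 ler_expR -mulr_sumr -mulrA -/(Z f) addrC subr_ge0.
  by rewrite ler_pM2l.
rewrite -mulr_sumr.
(* The sum over all patterns factors into one two-term sum, a Bernoulli moment generating function,
   per index. *)
rewrite -(bigA_distr_bigA (fun i (b : bool) => (if b then q i else 1 - q i) *
             expR (a * s * ((b%:R - q i) * ln (q i)))))/=.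
apply: (@le_trans _ _ (expR (- (a * (N * delta))) *
    \prod_(i : I) expR (a ^+ 2 / (2 * (1 - a))))).
  rewrite ler_pM2l ?expR_gt0//; apply: ler_prod => i _.
  rewrite big_bool /= addr_ge0 ?mulr_ge0 ?expR_ge0//=; last 2 first.
  - by have /andP[] := q01 i.
  - by have /andP[_] := q01 i; rewrite subr_ge0.
  have := @log_bernoulli_mgf_le R (q i) (a * s) (q01 i).
  rewrite na exprMn -[s ^+ 2]real_normK ?num_real// s1 expr1n mulr1.
  by apply; rewrite -subr_gt0 aE invr_gt0.
rewrite prodr_const -expRM_natl -expRD ler_expR aE.
rewrite le_eqVlt; apply/orP; left; apply/eqP.
by rewrite -[#|_|%:R]/N -mulr_natl -/N /a; field; rewrite gt_eqF.
Qed.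

Lemma chernoff_log_bernoulli_norm (R : realType) (I : finType) (q : I -> R)
    (delta : R) : (forall i, 0 <= q i <= 1) -> 0 < delta ->
  \sum_(f : {ffun I -> bool} | #|I|%:R * delta <=
      `| \sum_i ((f i)%:R - q i) * ln (q i) |)
    \prod_i (if f i then q i else 1 - q i) <=
  2 * expR (- (#|I|%:R * (delta ^+ 2 / (2 * (1 + delta))))).
Proof.
move=> q01 d0; rewrite [leRHS]mulr_natl mulr2n.
have H1 := @chernoff_log_bernoulli R I q 1 delta q01 (normr1 _) d0.
have H2 := @chernoff_log_bernoulli R I q (-1) delta q01 (normrN1 _) d0.
apply: le_trans (lerD H1 H2).
rewrite big_mkcond [X in _ <= X + _]big_mkcond [X in _ <= _ + X]big_mkcond/=.
rewrite -big_split/=; apply: ler_sum => f _.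
set Z := \sum_i _; rewrite mul1r mulN1r ler_normr.
have : 0 <= \prod_i (if f i then q i else 1 - q i).
  apply: prodr_ge0 => i _.
  by have /andP[? ?] := q01 i; case: ifP; rewrite ?subr_ge0.
by case: ifP => /=; case: ifP => /=; case: ifP => //=; lra.
Qed.

Lemma measure_cover_fin_le d (T : measurableType d) (R : realType)
    (mu : {measure set T -> \bar R}) (I : finType) (D : pred I)
    (A : I -> set T) (B : set T) :
  measurable B -> (forall i, measurable (A i)) ->
  (forall w, B w -> exists2 i, D i & A i w) ->
  (mu B <= \sum_(i | D i) mu (A i))%E.
Proof.
move=> mB mA BA.
have mU (s : seq I) : measurable (\big[setU/set0]_(i <- s | D i) A i).
  by apply: bigsetU_measurable => i _; exact: mA.
apply: (@le_trans _ _ (mu (\big[setU/set0]_(i | D i) A i))).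
  apply: le_measure; rewrite ?inE// => w /BA[i Di Aiw].
  by rewrite -bigcup_seq_cond; exists i => //=; rewrite mem_index_enum.
elim: (index_enum I) => [|i s IH]; first by rewrite !big_nil measure0.
rewrite !big_cons; case: ifP => // _.
by apply: le_trans (leeD (lexx _) IH); exact: measureU2.
Qed.

(** Independence applied to [A] or its complement at each index; it carries probabilities on [T] to
    the finite weights of the Chernoff bound. *)
Lemma probability_indicator_pattern d (T : measurableType d) (R : realType)
    (P : probability T R) d' (U : measurableType d') (I : finType)
    (X : I -> {RV P >-> U}) (A : set U) (q : I -> R) (f : {ffun I -> bool}) :
  mutually_independent X -> measurable A ->
  (forall i, P (X i @^-1` A) = (q i)%:E) ->
  P (\bigcap_(i in [set` [set: I]%SET])
      (X i @^-1` (if f i then A else ~` A))) =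
  (\prod_i (if f i then q i else 1 - q i))%:E.
Proof.
move=> Xi mA qE; rewrite (Xi [set: I]%SET (fun i => if f i then A else ~` A)).
  rewrite -prodEFin; apply: eq_big => [i|i _]; first by rewrite inE.
  case: ifP => _; first exact: qE.
  rewrite preimage_setC probability_setC; first by rewrite qE.
  by rewrite -[X in measurable X]setTI; exact: measurable_funPT.
by move=> i; case: ifP => // _; exact: measurableC.
Qed.

(* ln 0 = 0 in the library, so terms with p i k = 0 follow the convention
   0 log 0 = 0. *)
Theorem corollary1 (d : measure_display) (T : measurableType d) (R : realType)
    (P : probability T R) (n K : nat) (hn : (1 <= n)%N) (hK : (1 <= K)%N)
    (X : 'I_n -> {RV P >-> K.-tuple R}) (p : 'I_n -> 'I_K -> R)
    (Xmult : forall i, multinoulli (X i))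
    (Xindep : mutually_independent X)
    (pE : forall i k, P [set w | tnth (X i w) k = 1] = (p i k)%:E)
    (eps : R) (eps_gt0 : 0 < eps) :
  (P [set w | (n%:R * eps <=
       `| \sum_(i < n) \sum_(k < K) (tnth (X i w) k - p i k) * ln (p i k) |)%R]
   <= (2 * K%:R *
       expR (- (n%:R * eps ^+ 2 / (2 * K%:R * (K%:R + eps)))))%:E)%E.
Proof.
have K0 : 0 < K%:R :> R by rewrite ltr0n.
pose delta := eps / K%:R.
have d0 : 0 < delta by rewrite divr_gt0.
have mX i k : measurable_fun setT (fun w => tnth (X i w) k).
  by apply: (measurableT_comp (measurable_tnth k)).
pose A (k : 'I_K) : set (K.-tuple R) := [set x | tnth x k = 1].
have mA k : measurable (A k).
  rewrite -[A k]setTI.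
  exact: (measurable_tnth k measurableT (measurable_set1 (1 : R))).
have p01 i k : 0 <= p i k <= 1.
  rewrite -!lee_fin -pE measure_ge0/= probability_le1//.
  rewrite -[X in measurable X]setTI.
  exact: (mX i k measurableT _ (measurable_set1 (1 : R))).
pose C (kf : 'I_K * {ffun 'I_n -> bool}) : set T :=
  \bigcap_(i in [set` [set: 'I_n]%SET])
    (X i @^-1` (if kf.2 i then A kf.1 else ~` A kf.1)).
pose bad (kf : 'I_K * {ffun 'I_n -> bool}) := n%:R * delta <=
  `| \sum_i ((kf.2 i)%:R - p i kf.1) * ln (p i kf.1) |.
have PC kf : P (C kf) = (\prod_i (if kf.2 i then p i kf.1 else 1 - p i kf.1))%:E.
  apply: probability_indicator_pattern => // i; exact: pE.
(* [C (k, f)] is the event that the k-th coordinates show the pattern [f]. The union bound runs over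
   pairs of a coordinate and a bad pattern. *)
apply: (@le_trans _ _ (\sum_(kf | bad kf) P (C kf))%E).
  apply: measure_cover_fin_le.
  - rewrite -[X in measurable X]setTI; apply: measurable_fun_le => //.
    apply: measurableT_comp; first exact: measurable_realfun.normr_measurable.
    apply: measurable_sum => i; apply: measurable_sum => k.
    apply: measurable_realfun.measurable_funM => //.
    exact: measurable_realfun.measurable_funB.
  - move=> kf; apply: fin_bigcap_measurable => // i _.
    rewrite -[X in measurable X]setTI; apply: measurable_funPT => //.
    by case: ifP => // _; exact: measurableC.
  - move=> w /= Ew.
    pose f k := [ffun i => tnth (X i w) k == 1].
    (* One-hot entries are 0 or 1, so the observed pattern [f k] determines them. *)
    have fE i k : tnth (X i w) k = (f k i)%:R.
      rewrite ffunE; have [+ _] := Xmult i w => /(_ k)[] ->; rewrite ?eqxx//.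
      by rewrite eq_sym oner_eq0.
    have [/existsP[k Hk]|] := boolP [exists k, bad (k, f k)].
      exists (k, f k) => // i _ /=; rewrite ffunE; case: eqP => //.
    rewrite negb_exists => /forallP good; exfalso.
    move: Ew; apply/negP; rewrite -ltNge exchange_big/=.
    apply: le_lt_trans (ler_norm_sum _ _ _) _.
    apply: (@lt_le_trans _ _ (\sum_(k < K) n%:R * delta)).
      (* Strictness survives summation over a nonempty index set; [hK] supplies an index. *)
      apply: ltr_sum.
        by apply/hasP; exists (Ordinal hK); rewrite ?mem_index_enum.
      move=> k _; rewrite ltNge; apply: contra (good k).
      by rewrite /bad/=; under eq_bigr do rewrite fE.
    by rewrite sumr_const card_ord -[leLHS]mulr_natr -mulrA /delta divfK// gt_eqF.
rewrite (eq_bigr _ (fun kf _ => PC kf)) sumEFin lee_fin.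
(* For each fixed k, the inner sum is the two-sided Chernoff sum for the probabilities [p i k]. *)
rewrite -(pair_big_dep xpredT (fun k f => bad (k, f))
  (fun k (f : {ffun _}) => \prod_i (if f i then p i k else 1 - p i k)))/=.
apply: (@le_trans _ _ (\sum_(k < K) 2 * expR (- (n%:R * (delta ^+ 2 / (2 * (1 + delta))))))).
  apply: ler_sum => k _.
  have := @chernoff_log_bernoulli_norm R _ (p^~ k) delta (p01^~ k) d0.
  by rewrite card_ord.
rewrite sumr_const card_ord -[leLHS]mulr_natl mulrCA mulrA.
rewrite le_eqVlt; apply/orP; left; apply/eqP; congr (_ * expR (- _)).
by rewrite /delta; field; rewrite !gt_eqF//= ?addr_gt0.
Qed.
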